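(* Let $\alpha,\beta>-1$ be real and let $c\neq 0$ be real. For real $\epsilon\ne 0$ put $$q=-e^{\epsilon},\qquad a=-e^{\epsilon\alpha},\qquad b=-e^{\epsilon\beta},$$ let $L$ be the big $q$-Jacobi operator with parameters $a,b,c$ and let $P_n(x;a,b,c)$ be the monic big $q$-Jacobi polynomials (both recalled in the context). (i) For every differentiable function $f:\mathbb{R}\to\mathbb{R}$ and every $x\neq 0$, $$\lim_{\epsilon\to 0}\frac{1}{q+1}(Lf)(x)=(L_0f)(x):=g_0(x)\bigl(f(-x)-f(x)\bigr)-g_1(x)f'(-x),$$ where $$g_0(x)=\frac{(\alpha+\beta+1)x^2+(c\alpha-\beta)x+c}{x^2},\qquad g_1(x)=\frac{2(x-1)(x+c)}{x}.$$ Equivalently, $L_0=g_0(x)(R-I)+g_1(x)\partial_xR$, where $Rf(x)=f(-x)$ and $I$ is the identity. (ii) For every $N\ge 0$ the operator $L_0$ maps the space of polynomials of degree at most $N$ into itself. (iii) For every $n\ge 0$ the limit $P_n^{(-1)}(x)=\lim_{\epsilon\to0}P_n(x;a,b,c)$ exists (coefficientwise), is a monic polynomial of degree $n$, and satisfies $$L_0P_n^{(-1)}(x)=\lambda_nP_n^{(-1)}(x),\qquad \lambda_n=\begin{cases}2n,& n\text{ even},\\ -2(\alpha+\beta+n+1),& n\text{ odd}.\end{cases}$$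
   Context: The big $q$-Jacobi operator with parameters $a,b,c$ is $$Lf(x)=B(x)\bigl(f(xq)-f(x)\bigr)+D(x)\bigl(f(xq^{-1})-f(x)\bigr),$$ $$B(x)=\frac{aq(x-1)(bx-c)}{x^2},\qquad D(x)=\frac{(x-aq)(x-cq)}{x^2}.$$ The monic big $q$-Jacobi polynomials $P_n(x)=P_n(x;a,b,c)$ are defined by $P_{-1}=0$, $P_0=1$ and $$P_{n+1}(x)+b_nP_n(x)+u_nP_{n-1}(x)=xP_n(x),\qquad u_n=A_{n-1}C_n,\quad b_n=1-A_n-C_n,$$ where $$A_n=\frac{(1-aq^{n+1})(1-abq^{n+1})(1-cq^{n+1})}{(1-abq^{2n+1})(1-abq^{2n+2})},\qquad C_n=-acq^{n+1}\frac{(1-q^n)(1-abc^{-1}q^n)(1-bq^n)}{(1-abq^{2n+1})(1-abq^{2n})},$$ with $C_0=0$. It is known that $LP_n=(q^{-n}-1)(1-abq^{n+1})P_n$. *)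

(* Defs.v *)
From HB Require Import structures.
From mathcomp Require Import all_boot all_order all_algebra.
From mathcomp Require Import all_classical all_reals all_analysis.

Set Implicit Arguments.
Unset Strict Implicit.
Unset Printing Implicit Defensive.
Import Order.TTheory GRing.Theory Num.Theory.
Import numFieldNormedType.Exports.

Local Open Scope ring_scope.

Definition bqJ_B (F : fieldType) (q a b c x : F) : F :=
  a * q * (x - 1) * (b * x - c) / x ^+ 2.

Definition bqJ_D (F : fieldType) (q a b c x : F) : F :=
  (x - a * q) * (x - c * q) / x ^+ 2.

(* The big q-Jacobi operator L. *)
Definition bqJ_op (F : fieldType) (q a b c : F) (f : F -> F) (x : F) : F :=
  bqJ_B q a b c x * (f (x * q) - f x) + bqJ_D q a b c x * (f (x * q^-1) - f x).

Definition bqJ_A (F : fieldType) (q a b c : F) (n : nat) : F :=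
  (1 - a * q ^+ n.+1) * (1 - a * b * q ^+ n.+1) * (1 - c * q ^+ n.+1)
  / ((1 - a * b * q ^+ (2 * n + 1)) * (1 - a * b * q ^+ (2 * n + 2))).

(* C_0 = 0 is a convention: the denominator of the general formula may vanish
   at n = 0. *)
Definition bqJ_C (F : fieldType) (q a b c : F) (n : nat) : F :=
  if n is 0%N then 0 else
  - (a * c * q ^+ n.+1)
  * ((1 - q ^+ n) * (1 - a * b * c^-1 * q ^+ n) * (1 - b * q ^+ n))
  / ((1 - a * b * q ^+ (2 * n + 1)) * (1 - a * b * q ^+ (2 * n))).

(* Diagonal recurrence coefficient b_n = 1 - A_n - C_n. *)
Definition bqJ_b (F : fieldType) (q a b c : F) (n : nat) : F :=
  1 - bqJ_A q a b c n - bqJ_C q a b c n.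

(* Monic big q-Jacobi polynomials:
   P_(m+1) = x P_m - b_m P_m - u_m P_(m-1), with u_m = A_(m-1) C_m;
   the last term is absent for m = 0 because P_(-1) = 0. *)
Fixpoint bqJ_poly (F : fieldType) (q a b c : F) (n : nat) : {poly F} :=
  if n is m.+1 then
    'X * bqJ_poly q a b c m - bqJ_b q a b c m *: bqJ_poly q a b c m
    - (if m is k.+1 then
         (bqJ_A q a b c k * bqJ_C q a b c m) *: bqJ_poly q a b c k
       else 0)
  else 1.

Definition g0 (R : realType) (alpha beta c x : R) : R :=
  ((alpha + beta + 1) * x ^+ 2 + (c * alpha - beta) * x + c) / x ^+ 2.

Definition g1 (R : realType) (c x : R) : R := 2 * (x - 1) * (x + c) / x.

(* L_0 f x; only meaningful for x <> 0, since g0 and g1 have a pole at 0. *)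
Definition L0 (R : realType) (alpha beta c : R) (f : R -> R) (x : R) : R :=
  g0 alpha beta c x * (f (- x) - f x) - g1 c x * derive1 f (- x).

Definition reflection (R : realType) (f : R -> R) (x : R) : R := f (- x).

Definition lambda (R : realType) (alpha beta : R) (n : nat) : R :=
  if odd n then - 2 * (alpha + beta + n%:R + 1) else 2 * n%:R.

(* Main.v *)
Require Import Defs.
From HB Require Import structures.
From mathcomp Require Import all_boot all_order all_algebra.
From mathcomp Require Import all_classical all_reals all_analysis.
From mathcomp Require Import ring lra zify.

Set Implicit Arguments.
Unset Strict Implicit.
Unset Printing Implicit Defensive.
Import Order.TTheory GRing.Theory Num.Theory.
Import numFieldNormedType.Exports.

Local Open Scope classical_set_scope.
Local Open Scope ring_scope.

(** At [eps = 0] the parameters are [q = a = b = -1]; there [B] and [D] are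
    opposite and [x q = x / q = - x], so that [L f x] vanishes.  As [q + 1]
    vanishes to first order too, the limit in (i) is the quotient of two
    derivatives at [0] ([cvg_ratio], [cvg_bqJ_op]).  Part (ii) is a computation
    of [L0] on monomials: in [L0_monomial] the poles at [x = 0] cancel.

    For (iii), the coefficients of [P_n] are polynomials in the recurrence
    coefficients [A_m] and [C_m], so it is enough that these converge.  In the
    quotients that define [A_m] and, for [m >= 1], [C_m], the denominator has
    exactly one factor that tends to [0]; it has the form [1 - e^(eps s)] with
    [s > 0].  For either parity of [m] the numerator also has a factor
    [1 - e^(eps s')], and the quotient of the two tends to [s' / s]
    ([cvg_bqJ_A], [cvg_bqJ_C]).  Since [P_n] has degree [n] and [L] is linear,
    [(q + 1)^-1 L P_n] then converges at each [x != 0] to [L0] of the limit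
    polynomial, by (i) applied to monomials.  The eigenvalue equation for [L]
    therefore passes to the limit, the eigenvalue being treated in
    [cvg_bqJ_eigen].

    The eigenvalue equation at [eps != 0] is proved algebraically over any field
    in [bqJ_op_poly].  In the basis [(x;q)_k] the operator [L] is bidiagonal
    ([bqJ_op_qpochS]), so the terminating basic hypergeometric sum
    [3phi2(q^-n, a b q^(n+1), x; a q, c q; q, q)] is an eigenvector
    ([bqJ_op_hyper]).  Comparing coefficients in the same basis, this sum
    satisfies the three-term recurrence up to normalisation ([bqJ_hyper_rec]),
    hence [P_n] is a multiple of it ([bqJ_polyE]).  The denominators involved
    do not vanish for small [eps != 0], because [alpha, beta > -1]
    ([near_bqJ_nondegenerate]). *)

(** * q-shifted factorials *)

(** The q-shifted factorial [(u;q)_k]. *)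
Definition qpoch (F : fieldType) (q u : F) (k : nat) : F :=
  \prod_(j < k) (1 - u * q ^+ j).

Lemma qpoch0 (F : fieldType) (q u : F) : qpoch q u 0 = 1.
Proof. exact: big_ord0. Qed.

Lemma qpochSr (F : fieldType) (q u : F) k :
  qpoch q u k.+1 = qpoch q u k * (1 - u * q ^+ k).
Proof. exact: big_ord_recr. Qed.

Lemma qpochS (F : fieldType) (q u : F) k :
  qpoch q u k.+1 = (1 - u) * qpoch q (u * q) k.
Proof.
rewrite /qpoch big_ord_recl expr0 mulr1; congr (_ * _).
by apply: eq_bigr => j _; rewrite /= exprS mulrA.
Qed.

(** The factor of index [n] is [1 - q^-n q^n = 0]; this makes the
    hypergeometric sum below terminate. *)
Lemma qpoch_eq0 (F : fieldType) (q : F) n k :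
  q != 0 -> (n < k)%N -> qpoch q (q ^- n) k = 0.
Proof.
move=> q0 nk; rewrite /qpoch (bigD1 (Ordinal nk)) //=.
by rewrite mulVf ?expf_neq0 // subrr mul0r.
Qed.

Lemma qpoch_neq0 (F : fieldType) (q u : F) k :
  (forall j, (j < k)%N -> 1 - u * q ^+ j != 0) -> qpoch q u k != 0.
Proof. by move=> h; apply/prodf_neq0 => j _; exact: h. Qed.

Lemma mul_qpoch (F : fieldType) (q x : F) k : q != 0 ->
  x * qpoch q x k = q ^- k * (qpoch q x k - qpoch q x k.+1).
Proof.
move=> q0; have qk : q ^+ k != 0 by rewrite expf_neq0.
by rewrite qpochSr; field.
Qed.

(** * The hypergeometric eigenvectors of the big q-Jacobi operator *)

(** No denominator of the hypergeometric coefficients up to index [N], nor of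
    the recurrence coefficients, vanishes.  Only the condition on [c] is
    truncated: for [q = - e^eps] the one of index [j] can fail at
    [eps = - ln |c| / (j + 1)], and these values accumulate at [0]. *)
Definition bqJ_nondegenerate (F : fieldType) (q a b c : F) (N : nat) : Prop :=
  [/\ q != 0,
      forall j, 1 - q ^+ j.+1 != 0,
      forall j, 1 - a * q ^+ j.+1 != 0,
      forall j, 1 - a * b * q ^+ j.+1 != 0 &
      forall j, (j < N)%N -> 1 - c * q ^+ j.+1 != 0].

(** The [k]-th term of [3phi2(q^-n, a b q^(n+1), x; a q, c q; q, q)] is
    [bqJ_coef q a b c n k * qpoch q x k]. *)
Definition bqJ_coef (F : fieldType) (q a b c : F) (n k : nat) : F :=
  qpoch q (q ^- n) k * qpoch q (a * b * q ^+ n.+1) k * q ^+ k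
  / (qpoch q (a * q) k * qpoch q (c * q) k * qpoch q q k).

Definition bqJ_hyper (F : fieldType) (q a b c : F) (n : nat) (x : F) : F :=
  \sum_(k < n.+1) bqJ_coef q a b c n k * qpoch q x k.

Definition bqJ_eigen (F : fieldType) (q a b : F) (n : nat) : F :=
  (q ^- n - 1) * (1 - a * b * q ^+ n.+1).

Lemma bqJ_eigen0 (F : fieldType) (q a b : F) : bqJ_eigen q a b 0 = 0.
Proof. by rewrite /bqJ_eigen expr0 invr1 subrr mul0r. Qed.

Lemma bqJ_coef_eq0 (F : fieldType) (q a b c : F) n k :
  q != 0 -> (n < k)%N -> bqJ_coef q a b c n k = 0.
Proof. by move=> q0 nk; rewrite /bqJ_coef qpoch_eq0 // !mul0r. Qed.

(** The coefficients of index greater than [n] vanish, so that sums for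
    different degrees can be compared term by term over a common range. *)
Lemma bqJ_hyper_widen (F : fieldType) (q a b c : F) n N x :
  q != 0 -> (n < N)%N ->
  bqJ_hyper q a b c n x = \sum_(k < N) bqJ_coef q a b c n k * qpoch q x k.
Proof.
move=> q0 nN; rewrite /bqJ_hyper.
rewrite (big_ord_widen N (fun k => bqJ_coef q a b c n k * qpoch q x k)) //.
rewrite [RHS](bigID (fun k : 'I_N => (k < n.+1)%N)) /= [X in _ + X]big1 ?addr0 //.
by move=> k; rewrite -leqNgt => nk; rewrite bqJ_coef_eq0 // mul0r.
Qed.

Lemma bqJ_op_sum (F : fieldType) (q a b c : F) (N : nat) (u : 'I_N -> F)
    (f : 'I_N -> F -> F) x :
  bqJ_op q a b c (fun y => \sum_(k < N) u k * f k y) x =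
  \sum_(k < N) u k * bqJ_op q a b c (f k) x.
Proof.
rewrite /bqJ_op -!sumrB !mulr_sumr -big_split /=.
by apply: eq_bigr => k _; ring.
Qed.

Lemma bqJ_op_qpoch0 (F : fieldType) (q a b c x : F) :
  bqJ_op q a b c (fun y => qpoch q y 0) x = 0.
Proof. by rewrite /bqJ_op !qpoch0 !subrr !mulr0 addr0. Qed.

(** The factor [x - 1] of [B] turns [(q x;q)_(k+1)] into a multiple of
    [(x;q)_(k+1)], while [(x/q;q)_(k+1) = (1 - x/q) (x;q)_k]; in the sum of
    the two contributions the pole at [0] cancels. *)
Lemma bqJ_op_qpochS (F : fieldType) (q a b c x : F) k : q != 0 -> x != 0 ->
  bqJ_op q a b c (fun y => qpoch q y k.+1) x =
  bqJ_eigen q a b k.+1 * qpoch q x k.+1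
  + (1 - q ^- k.+1) * (1 - a * q ^+ k.+1) * (1 - c * q ^+ k.+1) * qpoch q x k.
Proof.
move=> q0 x0; rewrite /bqJ_op /bqJ_eigen.
have hB : bqJ_B q a b c x * (qpoch q (x * q) k.+1 - qpoch q x k.+1) =
   a * q * (b * x - c) / x * (q ^+ k.+1 - 1) * qpoch q x k.+1.
  rewrite /bqJ_B mulrBr.
  have -> : a * q * (x - 1) * (b * x - c) / x ^+ 2 * qpoch q (x * q) k.+1 =
     - (a * q * (b * x - c) / x ^+ 2) * ((1 - x) * qpoch q (x * q) k.+1) by ring.
  by rewrite -qpochS qpochSr; field.
have hx : qpoch q (x * q^-1) k.+1 = (1 - x * q^-1) * qpoch q x k.
  by rewrite qpochS mulfVK.
rewrite {}hB {}hx /bqJ_D qpochSr !exprS.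
have qk : q ^+ k != 0 by rewrite expf_neq0.
by move: (qpoch _ _ _) (q ^+ k) qk => G Q Q0; field; rewrite ?q0 ?x0 ?Q0.
Qed.

(** The ratio of consecutive hypergeometric coefficients, in the form that
    cancels the off-diagonal part of [L] against the diagonal part. *)
Lemma bqJ_coefS (F : fieldType) (q a b c : F) n k :
  bqJ_nondegenerate q a b c k.+1 ->
  (bqJ_eigen q a b n - bqJ_eigen q a b k) * bqJ_coef q a b c n k =
  (1 - q ^- k.+1) * (1 - a * q ^+ k.+1) * (1 - c * q ^+ k.+1)
   * bqJ_coef q a b c n k.+1.
Proof.
move=> [q0 hq ha hab hc]; rewrite /bqJ_coef !qpochSr /bqJ_eigen.
have pa : qpoch q (a * q) k != 0.
  by apply: qpoch_neq0 => j _; rewrite -mulrA -exprS ha.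
have pq : qpoch q q k != 0 by apply: qpoch_neq0 => j _; rewrite -exprS hq.
have pc : qpoch q (c * q) k != 0.
  by apply: qpoch_neq0 => j jk; rewrite -mulrA -exprS hc // ltnW // ltnS.
have := hq k; have := ha k; have := hc k (ltnSn k).
have : q ^+ k != 0 by rewrite expf_neq0.
have : q ^+ n != 0 by rewrite expf_neq0.
rewrite !exprS.
move: (qpoch q (a * q) k) (qpoch q q k) (qpoch q (c * q) k) pa pq pc.
move: (qpoch q (q ^- n) k) (qpoch q (a * b * (q * q ^+ n)) k) => G H.
move: (q ^+ k) (q ^+ n).
move=> K Q Da Dq Dc *; field.
by repeat (apply/andP; split); rewrite -?mulrA ?mulf_neq0.
Qed.

Lemma bqJ_op_hyper (F : fieldType) (q a b c : F) n x :
  bqJ_nondegenerate q a b c n -> x != 0 ->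
  bqJ_op q a b c (bqJ_hyper q a b c n) x =
  bqJ_eigen q a b n * bqJ_hyper q a b c n x.
Proof.
move=> nd x0; have q0 : q != 0 by case: nd.
rewrite [LHS]bqJ_op_sum big_ord_recl bqJ_op_qpoch0 mulr0 add0r /=.
under eq_bigr => k _ do rewrite bqJ_op_qpochS // mulrDr.
rewrite big_split /=.
set S1 := \sum_(_ < _) _; set S2 := \sum_(_ < _) _.
have -> : S1 = \sum_(k < n.+1)
   bqJ_eigen q a b k * bqJ_coef q a b c n k * qpoch q x k.
  rewrite big_ord_recl bqJ_eigen0 !mul0r add0r.
  by apply: eq_bigr => k _; rewrite lift0; ring.
have -> : S2 = \sum_(k < n.+1)
   (bqJ_eigen q a b n - bqJ_eigen q a b k) * bqJ_coef q a b c n k * qpoch q x k.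
  rewrite [RHS]big_ord_recr /= subrr !mul0r addr0.
  apply: eq_bigr => k _; rewrite /= /bump add1n bqJ_coefS; first by ring.
  case: nd => ? ? ? ? hc; split=> // j jk; apply: hc.
  by apply: leq_trans jk _.
rewrite -big_split /bqJ_hyper mulr_sumr /=.
by apply: eq_bigr => k _; ring.
Qed.

(** * The three-term recurrence *)

(** The three-term recurrence of the sums [y_n = bqJ_hyper q a b c n x], read
    on the coefficient of [(x;q)_k].  The right-hand side is the coefficient of
    [(x - 1) y_(n+1)], by [mul_qpoch].  For [k >= 2] all the terms are
    rational multiples of the product of [(q^-n;q)_(k-2)],
    [(a b q^(n+3);q)_(k-2)] and the common denominators, and a rational
    identity in [q^n] and [q^(k-2)] remains. *)
Lemma bqJ_coef_rec (F : fieldType) (q a b c : F) n k :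
  bqJ_nondegenerate q a b c k -> c != 0 ->
  bqJ_A q a b c n.+1 * bqJ_coef q a b c n.+2 k
  - (bqJ_A q a b c n.+1 + bqJ_C q a b c n.+1) * bqJ_coef q a b c n.+1 k
  + bqJ_C q a b c n.+1 * bqJ_coef q a b c n k =
  (q ^- k - 1) * bqJ_coef q a b c n.+1 k
  - (if k is l.+1 then q ^- l * bqJ_coef q a b c n.+1 l else 0).
Proof.
move=> [q0 hq ha hab hc] c0.
have Q0 : q ^+ n != 0 by rewrite expf_neq0.
have eu1 : q ^- n.+1 = q ^- n.+2 * q by rewrite !exprS; field; rewrite ?q0 ?Q0.
have eu2 : q ^- n = q ^- n.+2 * q * q by rewrite !exprS; field; rewrite ?q0 ?Q0.
have ev1 : a * b * q ^+ n.+2 = a * b * q ^+ n.+1 * q by rewrite !exprS; ring.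
have ev2 : a * b * q ^+ n.+3 = a * b * q ^+ n.+1 * q * q by rewrite !exprS; ring.
have d1 := hab (2 * n + 2)%N; have d2 := hab (2 * n + 3)%N.
have d3 := hab (2 * n + 1)%N.
have e1 : (2 * n.+1 + 1 = (2 * n + 2).+1)%N by lia.
have e2 : (2 * n.+1 + 2 = (2 * n + 3).+1)%N by lia.
have e3 : (2 * n.+1 = (2 * n + 1).+1)%N by lia.
rewrite /bqJ_A /bqJ_C e1 e2 e3.
have E1 : q ^+ (2 * n + 2).+1 = q ^+ n * q ^+ n * q * q * q.
  by rewrite exprS exprD mulnC exprM; ring.
have E2 : q ^+ (2 * n + 3).+1 = q ^+ n * q ^+ n * q * q * q * q.
  by rewrite exprS exprD mulnC exprM; ring.
have E3 : q ^+ (2 * n + 1).+1 = q ^+ n * q ^+ n * q * q.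
  by rewrite exprS exprD mulnC exprM; ring.
rewrite {e1 e2 e3} E1 E2 E3 in d1 d2 d3 *.
case: k hc => [|[|m]] hc; rewrite /bqJ_coef ?qpoch0.
- rewrite expr0 !exprS; move: (q ^+ n) Q0 d1 d2 d3 => Q Q0 d1 d2 d3.
  by field; rewrite ?c0 ?d1 ?d2 ?d3 ?mulrA ?oner_eq0.
- have := hq 0%N; have := ha 0%N; have := hc 0%N isT.
  rewrite !qpochSr !qpoch0 !exprS !expr0 !mulr1.
  move: (q ^+ n) Q0 d1 d2 d3 => Q Q0 d1 d2 d3 h1 h2 h3.
  by field; rewrite oner_eq0 h1 h2 h3 Q0 q0 c0 d1 d2 d3.
have pa : qpoch q (a * q) m != 0.
  by apply: qpoch_neq0 => j _; rewrite -mulrA -exprS ha.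
have pq : qpoch q q m != 0 by apply: qpoch_neq0 => j _; rewrite -exprS hq.
have pc : qpoch q (c * q) m != 0.
  by apply: qpoch_neq0 => j jk; rewrite -mulrA -exprS hc // ltnW // ltnW // ltnS.
have [ha0 ha1] := (ha m, ha m.+1).
have [hq0 hq1] := (hq m, hq m.+1).
have [hc0 hc1] := (hc m (ltnW (ltnSn _)), hc m.+1 (ltnSn _)).
rewrite eu1 eu2 ev1 ev2.
(* The four q-shifted factorials that occur for [u = q^-(n+2)] and for
   [u = a b q^(n+1)], in terms of the common part [(u q^2;q)_m]. *)
have p0 u : qpoch q u m.+2 = (1 - u) * (1 - u * q) * qpoch q (u * q * q) m.
  by rewrite !qpochS mulrA.
have p1 u : qpoch q (u * q) m.+2 =
    (1 - u * q) * qpoch q (u * q * q) m * (1 - u * q * q * q ^+ m).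
  by rewrite qpochS qpochSr mulrA.
have p2 u : qpoch q (u * q * q) m.+2 = qpoch q (u * q * q) m
     * (1 - u * q * q * q ^+ m) * (1 - u * q * q * q ^+ m.+1).
  by rewrite !qpochSr.
have p3 u : qpoch q (u * q) m.+1 = (1 - u * q) * qpoch q (u * q * q) m.
  by rewrite qpochS.
rewrite (p0 (q ^- n.+2)) (p1 (q ^- n.+2)) (p2 (q ^- n.+2)) (p3 (q ^- n.+2)).
set v := a * b * q ^+ n.+1; rewrite (p0 v) (p1 v) (p2 v) (p3 v) {p0 p1 p2 p3}.
rewrite !(qpochSr _ (_ * q) m.+1) !(qpochSr _ (_ * q) m).
rewrite !(qpochSr _ q m.+1) !(qpochSr _ q m).
have M0 : q ^+ m != 0 by rewrite expf_neq0.
move: (qpoch q (a * q) m) (qpoch q q m) (qpoch q (c * q) m) pa pq pc.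
move: (qpoch _ (q ^- _ * _ * _) m) (qpoch _ (v * _ * _) m) => G H Da Dq Dc.
move=> Da0 Dq0 Dc0; rewrite {}/v.
rewrite !exprS in ha0 ha1 hq0 hq1 hc0 hc1 *.
move: (q ^+ m) (q ^+ n) M0 Q0 d1 d2 d3 ha0 ha1 hq0 hq1 hc0 hc1.
move=> M Q M0 Q0 d1 d2 d3 ha0 ha1 hq0 hq1 hc0 hc1.
field.
by rewrite -!(mulrA a q) -!(mulrA c q) ha0 ha1 hc0 hc1 hq0 hq1 Da0
  Dc0 Dq0 Q0 q0 M0 c0 d1 d2 d3.
Qed.

Lemma bqJ_nondegenerateW (F : fieldType) (q a b c : F) M N :
  (M <= N)%N -> bqJ_nondegenerate q a b c N -> bqJ_nondegenerate q a b c M.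
Proof.
move=> MN [q0 hq ha hab hc]; split=> // j jM; apply: hc.
exact: leq_trans jM MN.
Qed.

Lemma bqJ_hyper_rec (F : fieldType) (q a b c : F) n x :
  bqJ_nondegenerate q a b c n.+2 -> c != 0 ->
  bqJ_A q a b c n.+1 * bqJ_hyper q a b c n.+2 x =
  (x - bqJ_b q a b c n.+1) * bqJ_hyper q a b c n.+1 x
  - bqJ_C q a b c n.+1 * bqJ_hyper q a b c n x.
Proof.
move=> nd c0; have q0 : q != 0 by case: nd.
set A := bqJ_A _ _ _ _ n.+1; set C := bqJ_C _ _ _ _ _.
have -> : x - bqJ_b q a b c n.+1 = x - 1 + (A + C).
  by rewrite /bqJ_b -/A -/C; ring.
have hx : (x - 1) * bqJ_hyper q a b c n.+1 x = \sum_(k < n.+3)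
    ((q ^- k - 1) * bqJ_coef q a b c n.+1 k
     - (if nat_of_ord k is l.+1 then q ^- l * bqJ_coef q a b c n.+1 l else 0))
    * qpoch q x k.
  under eq_bigr => k _ do rewrite mulrBl.
  rewrite sumrB [X in _ = _ - X]big_ord_recl mul0r add0r.
  rewrite big_ord_recr /= bqJ_coef_eq0 // mulr0 mul0r addr0.
  rewrite -sumrB /bqJ_hyper mulr_sumr; apply: eq_bigr => k _.
  rewrite /= /bump add1n; have := mul_qpoch x k q0.
  by move: (bqJ_coef _ _ _ _ _ _) => t e; rewrite mulrBl mul1r mulrCA e; ring.
rewrite mulrDl hx (@bqJ_hyper_widen _ q a b c n n.+3) //; last by rewrite ltnW.
rewrite (@bqJ_hyper_widen _ q a b c n.+1 n.+3) //.
rewrite /bqJ_hyper !mulr_sumr -big_split -sumrB /=.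
apply: eq_bigr => k _; rewrite -bqJ_coef_rec -/A -/C //; first by ring.
by apply: bqJ_nondegenerateW nd; rewrite -ltnS.
Qed.

Lemma bqJ_hyper0 (F : fieldType) (q a b c x : F) : bqJ_hyper q a b c 0 x = 1.
Proof.
rewrite /bqJ_hyper big_ord_recl big_ord0 addr0 /bqJ_coef !qpoch0.
by rewrite expr0 !mulr1 divr1.
Qed.

Lemma bqJ_hyper_rec0 (F : fieldType) (q a b c x : F) :
  bqJ_nondegenerate q a b c 1 ->
  bqJ_A q a b c 0 * bqJ_hyper q a b c 1 x = x - bqJ_b q a b c 0.
Proof.
move=> [q0 hq ha hab hc].
have := hq 0%N; have := ha 0%N; have := hab 0%N; have := hab 1%N.
have := hc 0%N isT; rewrite /bqJ_b /= subr0 /bqJ_A.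
rewrite /bqJ_hyper !big_ord_recl big_ord0 /bqJ_coef /= !qpochSr !qpoch0.
rewrite !exprS !expr0 !mulr1 => h1 h2 h3 h4 h5.
by field; rewrite oner_eq0 h1 h2 h3 h4 h5 q0.
Qed.

(** The normalisation comes from the recurrences: that of [bqJ_hyper] carries
    the leading factor [A_n], that of the monic [P_n] the factor 1. *)
Lemma bqJ_polyE (F : fieldType) (q a b c : F) N :
  bqJ_nondegenerate q a b c N -> c != 0 -> forall n x, (n <= N)%N ->
  (bqJ_poly q a b c n).[x] = \prod_(j < n) bqJ_A q a b c j * bqJ_hyper q a b c n x.
Proof.
move=> nd c0 n x nN.
suff: (bqJ_poly q a b c n).[x] =
        \prod_(j < n) bqJ_A q a b c j * bqJ_hyper q a b c n x /\
      ((n < N)%N -> (bqJ_poly q a b c n.+1).[x] =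
        \prod_(j < n.+1) bqJ_A q a b c j * bqJ_hyper q a b c n.+1 x).
  by case.
elim: n nN => [_|n IHn nN].
  rewrite /= big_ord0 mul1r hornerE bqJ_hyper0; split => // N0.
  rewrite big_ord1 /= bqJ_hyper_rec0.
    by rewrite !hornerE subr0.
  exact: (bqJ_nondegenerateW N0).
have [e0 e1] := IHn (ltnW nN); split; first exact: e1.
move=> n1N; have := bqJ_hyper_rec x (bqJ_nondegenerateW n1N nd) c0 => h.
have -> : bqJ_poly q a b c n.+2 = 'X * bqJ_poly q a b c n.+1
    - bqJ_b q a b c n.+1 *: bqJ_poly q a b c n.+1
    - (bqJ_A q a b c n * bqJ_C q a b c n.+1) *: bqJ_poly q a b c n by [].
rewrite !hornerD !hornerN !hornerZ hornerM hornerX e1 // e0.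
rewrite [in RHS]big_ord_recr -[RHS]mulrA [X in _ = _ * X]h.
by rewrite !big_ord_recr; move: (\prod_(j < n) _) => p /=; ring.
Qed.

(** The difference equation [L P_n = (q^-n - 1)(1 - a b q^(n+1)) P_n]. *)
Lemma bqJ_op_poly (F : fieldType) (q a b c : F) n x :
  bqJ_nondegenerate q a b c n -> c != 0 -> x != 0 ->
  bqJ_op q a b c (horner (bqJ_poly q a b c n)) x =
  bqJ_eigen q a b n * (bqJ_poly q a b c n).[x].
Proof.
move=> nd c0 x0; have e y := bqJ_polyE nd c0 y (leqnn n).
have := bqJ_op_hyper nd x0; rewrite /bqJ_op !e => h.
by rewrite mulrCA -h; ring.
Qed.

(** * Signed exponentials and their first-order behaviour *)

Lemma cvg_slope (R : realType) (f : R -> R) (df : R) :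
  is_derive (0 : R) (1 : R) f df -> f 0 = 0 ->
  eps^-1 * f eps @[eps --> (0 : R)^'] --> df.
Proof.
move=> [hf hdf] f0.
have -> : (fun eps => eps^-1 * f eps) =
    (fun h => h^-1 *: ((f \o shift 0) (h *: (1 : R)) - f 0)).
  by apply/funext => h /=; rewrite f0 subr0 addr0 /GRing.scale /= mulr1.
by rewrite -hdf; exact: hf.
Qed.

Lemma cvg_ratio (R : realType) (f g : R -> R) (df dg : R) :
  is_derive (0 : R) (1 : R) f df -> is_derive (0 : R) (1 : R) g dg ->
  f 0 = 0 -> g 0 = 0 -> dg != 0 ->
  f eps / g eps @[eps --> (0 : R)^'] --> df / dg.
Proof.
move=> hf hg f0 g0 dg0.
have h : (eps^-1 * f eps) / (eps^-1 * g eps) @[eps --> (0 : R)^'] --> df / dg.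
  by apply: cvgM; [exact: cvg_slope|apply: cvgV => //; exact: cvg_slope].
apply: (cvg_trans _ h); apply: near_eq_cvg; near=> e.
have e0 : e != 0 by near: e; exact: nbhs_dnbhs_neq.
by rewrite -mulf_div divff ?invr_neq0 // mul1r.
Unshelve. all: by end_near. Qed.

(** With [signed_exp m s eps = (-1)^m e^(eps s)], each of [q], [a], [b] and
    each monomial in them is of this form.  The parity of [m] decides whether
    [1 - signed_exp m s eps] vanishes at [eps = 0]. *)
Definition signed_exp (R : realType) (m : nat) (s eps : R) : R :=
  (-1) ^+ m * expR (eps * s).

Lemma signed_exp_eq (R : realType) m m' (s s' e : R) :
  odd m = odd m' -> s = s' -> signed_exp m s e = signed_exp m' s' e.
Proof. by move=> h ->; rewrite /signed_exp -signr_odd h signr_odd. Qed.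

Lemma signed_expD (R : realType) m m' (s s' eps : R) :
  signed_exp m s eps * signed_exp m' s' eps = signed_exp (m + m') (s + s') eps.
Proof. by rewrite /signed_exp mulrDr expRD exprD mulrACA. Qed.

Lemma signed_expX (R : realType) m k (s eps : R) :
  signed_exp m s eps ^+ k = signed_exp (m * k) (s * k%:R) eps.
Proof. by rewrite /signed_exp exprMn -exprM mulrA expRM_natr. Qed.

Lemma signed_expV (R : realType) m (s eps : R) :
  (signed_exp m s eps)^-1 = signed_exp m (- s) eps.
Proof.
rewrite /signed_exp mulrN expRN invfM -signr_odd.
by case: (odd m); rewrite ?expr1 ?expr0 ?invrN ?invr1.
Qed.

Lemma signed_exp0 (R : realType) m (s : R) : signed_exp m s 0 = (-1) ^+ m.
Proof. by rewrite /signed_exp mul0r expR0 mulr1. Qed.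

Lemma signed_exp_neq0 (R : realType) m (s eps : R) : signed_exp m s eps != 0.
Proof. by rewrite mulf_neq0 ?signr_eq0 // gt_eqF ?expR_gt0. Qed.

Lemma signed_exp_neq1 (R : realType) m (s eps : R) :
  odd m || (s != 0) -> eps != 0 -> 1 - signed_exp m s eps != 0.
Proof.
rewrite /signed_exp -signr_odd; case: (odd m) => /= [_|s0] e0.
  by rewrite expr1 mulN1r opprK gt_eqF // addr_gt0 // expR_gt0.
rewrite expr0 mul1r subr_eq0 eq_sym -expR0 (inj_eq (@expR_inj R)).
by rewrite mulf_neq0.
Qed.

#[local] Instance is_derive_signed_exp (R : realType) m (s x : R) :
  is_derive x (1 : R) (signed_exp m s) (s * signed_exp m s x).
Proof.
have h1 : is_derive x (1 : R) (fun eps : R => eps * s) s.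
  have -> : (fun eps : R => eps * s) = (s \*: id).
    by apply/funext => y /=; rewrite mulrC.
  by apply: is_derive_eq; rewrite /GRing.scale /= mulr1.
have h2 := @is_derive1_comp R expR ( *%R^~ s) x _ _ (is_derive_expR (x * s)) h1.
have -> : signed_exp m s = ((-1) ^+ m \*: (expR \o (fun eps : R => eps * s))).
  by apply/funext.
by apply: is_derive_eq; rewrite /= /GRing.scale /= /GRing.scale /=; ring.
Qed.

Lemma cvg_signed_exp (R : realType) m (s : R) :
  signed_exp m s eps @[eps --> (0 : R)^'] --> ((-1) ^+ m : R).
Proof.
rewrite -(signed_exp0 m s); apply: cvg_within_filter.
apply: differentiable_continuous; apply/derivable1_diffP.
exact: ex_derive.
Qed.

Lemma cvg_one_sub_signed_exp (R : realType) m (s : R) :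
  1 - signed_exp m s eps @[eps --> (0 : R)^'] --> (1 - (-1) ^+ m : R).
Proof. by apply: cvgB; [exact: cvg_cst|exact: cvg_signed_exp]. Qed.

Lemma cvg_one_sub_signed_exp_ratio (R : realType) m m' (s s' : R) :
  ~~ odd m -> ~~ odd m' -> s' != 0 ->
  (1 - signed_exp m s eps) / (1 - signed_exp m' s' eps)
    @[eps --> (0 : R)^'] --> s / s'.
Proof.
move=> em em' s0.
have h k (t : R) : ~~ odd k ->
    is_derive (0 : R) (1 : R) (fun e => 1 - signed_exp k t e) (- t).
  move=> ek; have -> : (fun e => 1 - signed_exp k t e) = cst 1 - signed_exp k t.
    by apply/funext.
  apply: is_derive_eq.
  by rewrite signed_exp0 -signr_odd (negbTE ek) expr0 mulr1 sub0r.
have -> : s / s' = - s / - s' by rewrite invrN mulrNN.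
apply: cvg_ratio; [exact: h|exact: h|..].
- by rewrite signed_exp0 -signr_odd (negbTE em) expr0 subrr.
- by rewrite signed_exp0 -signr_odd (negbTE em') expr0 subrr.
- by rewrite oppr_eq0.
Qed.

(** * Nondegeneracy for small nonzero parameters *)

Lemma near_dnbhs0_neq (R : realType) (r : R) : \forall e \near (0 : R)^', e != r.
Proof.
have [->|r0] := eqVneq r 0; first exact: nbhs_dnbhs_neq.
have r0' : 0 < `|r| by rewrite normr_gt0.
near=> e; apply/eqP => er.
have : `|e| < `|r| by near: e; exact: dnbhs0_lt.
by rewrite er ltxx.
Unshelve. all: by end_near. Qed.

(** The only possible zero is [eps = - ln |c| / s].  It is [0] itself when
    [|c| = 1], and then the punctured neighbourhood avoids it. *)
Lemma near_mul_signed_exp_neq1 (R : realType) (c : R) m s : s != 0 ->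
  \forall e \near (0 : R)^', 1 - c * signed_exp m s e != 0.
Proof.
move=> s0; near=> e; rewrite subr_eq0; apply/eqP => h.
have : e != - ln `|c| / s by near: e; exact: near_dnbhs0_neq.
have c0 : 0 < `|c|.
  rewrite normr_gt0; apply/eqP => c0; move: h; rewrite c0 mul0r.
  by move/eqP; rewrite oner_eq0.
move/eqP; apply; apply: (mulIf s0); rewrite mulfVK //.
(* Taking absolute values loses the sign [(-1)^m] and gives
   [1 = e^(ln |c|) e^(e s)]. *)
have := congr1 Num.norm h; rewrite normr1 !normrM normrX normrN1 expr1n mul1r.
rewrite (gtr0_norm (expR_gt0 _)) -[X in X * _](@lnK R) ?posrE //.
rewrite -expRD -[1]expR0 => /expR_inj; lra.
Unshelve. all: by end_near. Qed.

(** In [a q^(j+1)] the exponent [alpha + j + 1] is positive.  In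
    [a b q^(j+1)] the exponent [alpha + beta + j + 1] is positive for
    [j >= 1]; for [j = 0] it may vanish, but then the sign is [-1]. *)
Lemma near_bqJ_nondegenerate (R : realType) (alpha beta c : R) N :
  -1 < alpha -> -1 < beta ->
  \forall e \near (0 : R)^', bqJ_nondegenerate (signed_exp 1 1 e)
     (signed_exp 1 alpha e) (signed_exp 1 beta e) c N.
Proof.
move=> ha hb.
have hN : \forall e \near (0 : R)^',
    forall j : 'I_N, 1 - c * signed_exp j.+1 j.+1%:R e != 0.
  by apply: filter_forall => j; apply: near_mul_signed_exp_neq1; rewrite pnatr_eq0.
near=> e.
have e0 : e != 0 by near: e; exact: nbhs_dnbhs_neq.
have hj : forall j : 'I_N, 1 - c * signed_exp j.+1 j.+1%:R e != 0 by near: e.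
split => [|j|j|j|j jN]; first exact: signed_exp_neq0.
- by rewrite signed_expX signed_exp_neq1 // mul1r pnatr_eq0 orbT.
- rewrite signed_expX signed_expD signed_exp_neq1 // mul1r gt_eqF ?orbT //.
  have : (1 : R) <= j.+1%:R by rewrite ler1n.
  lra.
- rewrite signed_expX !signed_expD signed_exp_neq1 // !mul1n mul1r.
  case: j => // j; rewrite gt_eqF ?orbT //.
  have : (2 : R) <= j.+2%:R by rewrite ler_nat.
  lra.
- by rewrite signed_expX mul1r mul1n; exact: (hj (Ordinal jN)).
Unshelve. all: by end_near. Qed.

(** * Convergence of the recurrence coefficients and of the polynomials *)

(** The factor [1 - a b q^(2n+2)] of the denominator tends to [0] like
    [- eps (alpha + beta + 2n + 2)]; in the numerator [1 - a q^(n+1)] tends to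
    [0] for [n] even, and [1 - a b q^(n+1)] for [n] odd. *)
Lemma cvg_bqJ_A (R : realType) (alpha beta c : R) n :
  -1 < alpha -> -1 < beta ->
  cvg (bqJ_A (signed_exp 1 1 e) (signed_exp 1 alpha e) (signed_exp 1 beta e) c n
         @[e --> (0 : R)^']).
Proof.
move=> ha hb.
pose E m s e : R := 1 - signed_exp m s e.
have n0 : (0 : R) <= n%:R by rewrite ler0n.
have s0 : alpha + beta + 2 * n%:R + 2 != 0 by rewrite gt_eqF //; lra.
have n2 : (2 : R) != 0 by rewrite pnatr_eq0.
have hc : 1 - c * signed_exp n.+1 n.+1%:R e @[e --> (0 : R)^']
    --> 1 - c * (-1) ^+ n.+1.
  apply: cvgB; first exact: cvg_cst.
  by apply: cvgM; [exact: cvg_cst|exact: cvg_signed_exp].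
have hD : (E (2 * n).+1 (alpha + beta + 2 * n%:R + 1) e)^-1 @[e --> (0 : R)^']
    --> (2 : R)^-1.
  apply: cvgV => //; have := @cvg_one_sub_signed_exp R (2 * n).+1
    (alpha + beta + 2 * n%:R + 1).
  by rewrite -signr_odd /= mul2n odd_double /= expr1 opprK.
have eA e : bqJ_A (signed_exp 1 1 e) (signed_exp 1 alpha e) (signed_exp 1 beta e) c n
   = (E n (alpha + n.+1%:R) e * E n.+1 (alpha + beta + n.+1%:R) e
      / E 0 (alpha + beta + 2 * n%:R + 2) e)
     * (1 - c * signed_exp n.+1 n.+1%:R e)
     / E (2 * n).+1 (alpha + beta + 2 * n%:R + 1) e.
  rewrite /bqJ_A !signed_expX !signed_expD /E.
  rewrite (@signed_exp_eq _ (1 + 1 * n.+1) n _ (alpha + n.+1%:R)); [|lia|ring].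
  rewrite (@signed_exp_eq _ (1 + 1 + 1 * n.+1) n.+1 _ (alpha + beta + n.+1%:R));
    [|lia|ring].
  rewrite (@signed_exp_eq _ (1 * n.+1) n.+1 _ n.+1%:R); [|lia|ring].
  rewrite (@signed_exp_eq _ (1 + 1 + 1 * (2 * n + 1)) (2 * n).+1 _
    (alpha + beta + 2 * n%:R + 1)); [|lia|ring].
  rewrite (@signed_exp_eq _ (1 + 1 + 1 * (2 * n + 2)) 0 _
    (alpha + beta + 2 * n%:R + 2)); [|lia|ring].
  by rewrite invfM; ring.
rewrite (funext eA).
suff [l hl] : exists l : R, E n (alpha + n.+1%:R) e * E n.+1 (alpha + beta + n.+1%:R) e
      / E 0 (alpha + beta + 2 * n%:R + 2) e @[e --> (0 : R)^'] --> l.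
  exact: (cvgP _ (cvgM (cvgM hl hc) hD)).
have [on|en] := boolP (odd n).
  eexists; under eq_cvg do rewrite -mulrA.
  apply: cvgM; first exact: cvg_one_sub_signed_exp.
  by apply: cvg_one_sub_signed_exp_ratio; rewrite //= on.
eexists; under eq_cvg do rewrite mulrAC.
by apply: cvgM; [exact: cvg_one_sub_signed_exp_ratio|exact: cvg_one_sub_signed_exp].
Qed.

(** For [n >= 1], the vanishing factor of the denominator is
    [1 - a b q^(2n)]; in the numerator it is [1 - q^n] for [n] even, and
    [1 - b q^n] for [n] odd. *)
Lemma cvg_bqJ_C (R : realType) (alpha beta c : R) n :
  -1 < alpha -> -1 < beta ->
  cvg (bqJ_C (signed_exp 1 1 e) (signed_exp 1 alpha e) (signed_exp 1 beta e) c n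
         @[e --> (0 : R)^']).
Proof.
move=> ha hb; case: n => [|m]; first exact: is_cvg_cst.
set n := m.+1.
pose E m s e : R := 1 - signed_exp m s e.
have n1 : (1 : R) <= n%:R by rewrite ler1n.
have s0 : alpha + beta + 2 * n%:R != 0 by rewrite gt_eqF //; lra.
have n2 : (2 : R) != 0 by rewrite pnatr_eq0.
have hc : - (c * signed_exp n (alpha + n.+1%:R) e)
    * (1 - c^-1 * signed_exp n (alpha + beta + n%:R) e) @[e --> (0 : R)^']
    --> - (c * (-1) ^+ n) * (1 - c^-1 * (-1) ^+ n).
  apply: cvgM.
    by apply: cvgN; apply: cvgM; [exact: cvg_cst|exact: cvg_signed_exp].
  apply: cvgB; first exact: cvg_cst.
  by apply: cvgM; [exact: cvg_cst|exact: cvg_signed_exp].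
have hD : (E (2 * n).+1 (alpha + beta + 2 * n%:R + 1) e)^-1 @[e --> (0 : R)^']
    --> (2 : R)^-1.
  apply: cvgV => //; have := @cvg_one_sub_signed_exp R (2 * n).+1
    (alpha + beta + 2 * n%:R + 1).
  by rewrite -signr_odd oddS mul2n odd_double /= expr1 opprK.
have eC e : bqJ_C (signed_exp 1 1 e) (signed_exp 1 alpha e) (signed_exp 1 beta e) c n
   = (E n n%:R e * E n.+1 (beta + n%:R) e / E 0 (alpha + beta + 2 * n%:R) e)
     * (- (c * signed_exp n (alpha + n.+1%:R) e)
        * (1 - c^-1 * signed_exp n (alpha + beta + n%:R) e))
     / E (2 * n).+1 (alpha + beta + 2 * n%:R + 1) e.
  rewrite /bqJ_C /n -/n.
  have -> : signed_exp 1 alpha e * c * signed_exp 1 1 e ^+ n.+1 =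
      c * (signed_exp 1 alpha e * signed_exp 1 1 e ^+ n.+1) by ring.
  have -> : signed_exp 1 alpha e * signed_exp 1 beta e * c^-1 * signed_exp 1 1 e ^+ n =
      c^-1 * (signed_exp 1 alpha e * signed_exp 1 beta e * signed_exp 1 1 e ^+ n).
    by ring.
  rewrite !signed_expX !signed_expD /E.
  rewrite (@signed_exp_eq _ (1 + 1 * n.+1) n _ (alpha + n.+1%:R)); [|lia|ring].
  rewrite (@signed_exp_eq _ (1 * n) n _ n%:R); [|lia|ring].
  rewrite (@signed_exp_eq _ (1 + 1 + 1 * n) n _ (alpha + beta + n%:R));
    [|lia|ring].
  rewrite (@signed_exp_eq _ (1 + 1 * n) n.+1 _ (beta + n%:R)); [|lia|ring].
  rewrite (@signed_exp_eq _ (1 + 1 + 1 * (2 * n + 1)) (2 * n).+1 _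
    (alpha + beta + 2 * n%:R + 1)); [|lia|ring].
  rewrite (@signed_exp_eq _ (1 + 1 + 1 * (2 * n)) 0 _
    (alpha + beta + 2 * n%:R)); [|lia|ring].
  by rewrite invfM; ring.
rewrite (funext eC).
suff [l hl] : exists l : R, E n n%:R e * E n.+1 (beta + n%:R) e
      / E 0 (alpha + beta + 2 * n%:R) e @[e --> (0 : R)^'] --> l.
  exact: (cvgP _ (cvgM (cvgM hl hc) hD)).
have [on|en] := boolP (odd n).
  eexists; under eq_cvg do rewrite -mulrA.
  apply: cvgM; first exact: cvg_one_sub_signed_exp.
  by apply: cvg_one_sub_signed_exp_ratio => //; rewrite oddS on.
eexists; under eq_cvg do rewrite mulrAC.
by apply: cvgM; [exact: cvg_one_sub_signed_exp_ratio|exact: cvg_one_sub_signed_exp].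
Qed.

Lemma bqJ_polySS (F : fieldType) (q a b c : F) n :
  bqJ_poly q a b c n.+2 = 'X * bqJ_poly q a b c n.+1
    - bqJ_b q a b c n.+1 *: bqJ_poly q a b c n.+1
    - (bqJ_A q a b c n * bqJ_C q a b c n.+1) *: bqJ_poly q a b c n.
Proof. by []. Qed.

Lemma bqJ_poly1 (F : fieldType) (q a b c : F) :
  bqJ_poly q a b c 1 = 'X - (bqJ_b q a b c 0)%:P.
Proof. by rewrite /= mulr1 subr0 alg_polyC. Qed.

Lemma cvg_bqJ_poly (R : realType) (alpha beta c : R) n k :
  -1 < alpha -> -1 < beta ->
  cvg ((bqJ_poly (signed_exp 1 1 e) (signed_exp 1 alpha e)
          (signed_exp 1 beta e) c n)`_k @[e --> (0 : R)^']).
Proof.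
move=> ha hb.
pose p n e := bqJ_poly (signed_exp 1 1 e) (signed_exp 1 alpha e)
  (signed_exp 1 beta e) c n.
have hA m := @cvg_bqJ_A R alpha beta c m ha hb.
have hC m := @cvg_bqJ_C R alpha beta c m ha hb.
have hB m : cvg (bqJ_b (signed_exp 1 1 e) (signed_exp 1 alpha e)
    (signed_exp 1 beta e) c m @[e --> (0 : R)^']).
  exact: is_cvgB (is_cvgB (is_cvg_cst _) (hA m)) (hC m).
suff: (forall k, cvg ((p n e)`_k @[e --> (0 : R)^'])) /\
      (forall k, cvg ((p n.+1 e)`_k @[e --> (0 : R)^'])) by case.
elim: n {k} => [|n [IH0 IH1]]; split=> // k.
- by rewrite /p /=; exact: is_cvg_cst.
- rewrite /p; under eq_fun do rewrite bqJ_poly1 coefB coefX coefC.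
  apply: is_cvgB; first exact: is_cvg_cst.
  by case: (k == 0%N); [exact: hB | exact: is_cvg_cst].
- rewrite /p; under eq_fun do rewrite bqJ_polySS !coefB !coefZ coefXM.
  apply: is_cvgB; last exact: is_cvgM (is_cvgM (hA _) (hC _)) (IH0 _).
  apply: is_cvgB; last exact: is_cvgM (hB _) (IH1 _).
  by case: (k == 0%N); [exact: is_cvg_cst | exact: IH1].
Qed.

Lemma bqJ_poly_monic (F : fieldType) (q a b c : F) n :
  bqJ_poly q a b c n \is monic /\ size (bqJ_poly q a b c n) = n.+1.
Proof.
suff: (bqJ_poly q a b c n \is monic /\ size (bqJ_poly q a b c n) = n.+1) /\
  (bqJ_poly q a b c n.+1 \is monic /\ size (bqJ_poly q a b c n.+1) = n.+2).
  by case.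
elim: n => [|n [[IH0 sz0] [IH1 sz1]]].
  split; first by rewrite monic1 size_poly1.
  by rewrite bqJ_poly1 monicXsubC size_XsubC.
split=> //; rewrite bqJ_polySS -addrA.
set P := bqJ_poly q a b c n.+1; set S := - _ + _.
have szX : size ('X * P) = n.+3.
  by rewrite mulrC size_mulX ?monic_neq0 // /P sz1.
have szS : (size S < size ('X * P)%R)%N.
  rewrite szX ltnS (leq_trans (size_polyD _ _)) // !size_polyN geq_max.
  rewrite (leq_trans (size_scale_leq _ _)) ?sz1 //.
  by rewrite (leq_trans (size_scale_leq _ _)) ?sz0.
rewrite size_polyDl // szX monicE lead_coefDl // lead_coefM lead_coefX mul1r.
by rewrite -monicE.
Qed.

(** * The limit of the operator *)

(** The sum and product rules with the functions applied pointwise, so that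
    unification finds the summands and factors of an explicit expression. *)
Lemma is_derive_addf (R : realType) (f g : R -> R) (x df dg : R) :
  is_derive x (1 : R) f df -> is_derive x (1 : R) g dg ->
  is_derive x (1 : R) (fun t => f t + g t) (df + dg).
Proof. exact: is_deriveD. Qed.

Lemma is_derive_mulf (R : realType) (f g : R -> R) (x df dg : R) :
  is_derive x (1 : R) f df -> is_derive x (1 : R) g dg ->
  is_derive x (1 : R) (fun t => f t * g t) (f x * dg + g x * df).
Proof. exact: is_deriveM. Qed.

Lemma L0_reflection (R : realType) (alpha beta c : R) (f : R -> R) (x : R) :
  (forall y, derivable f y 1) ->
  L0 alpha beta c f x = g0 alpha beta c x * (reflection f x - f x)
                        + g1 c x * derive1 (reflection f) x.
Proof.
move=> hf.
have h : is_derive x (1 : R) (reflection f) (derive1 f (- x) * (- 1)).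
  apply: (@is_derive1_comp R f (fun y => - y)).
    by split; [exact: hf | rewrite derive1E].
by rewrite (derive1E (reflection f)) derive_val /L0 /reflection; ring.
Qed.

Lemma cvg_bqJ_op (R : realType) (alpha beta c : R) (f : R -> R) (x : R) :
  (forall y, derivable f y 1) -> x != 0 ->
  (signed_exp 1 1 e + 1)^-1 * bqJ_op (signed_exp 1 1 e) (signed_exp 1 alpha e)
     (signed_exp 1 beta e) c f x @[e --> (0 : R)^'] --> L0 alpha beta c f x.
Proof.
move=> hf x0.
have hc (k t : R) : is_derive (t : R) (1 : R) (fun=> k) 0 by exact: is_derive_cst.
have hs m s : is_derive (0 : R) (1 : R) (signed_exp m s) (s * (-1) ^+ m).
  by rewrite -(signed_exp0 m s); exact: is_derive_signed_exp.
have hfc s : is_derive (0 : R) (1 : R) (fun e => f (x * signed_exp 1 s e))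
    (derive1 f (- x) * (- x * s)).
  apply: (@is_derive1_comp R f (fun e => x * signed_exp 1 s e)).
    by rewrite signed_exp0 expr1 mulrN1; split; [exact: hf | rewrite derive1E].
  apply: (is_derive_eq (is_derive_mulf (hc x 0) (hs 1%N s))).
  by rewrite expr1; ring.
(* The expressions of [B] and [D] in [eps], using
   [a q = signed_exp 0 (alpha + 1)]. *)
pose B e := (signed_exp 0 (alpha + 1) e * (x - 1))
   * (signed_exp 1 beta e * x + - c) * (x ^+ 2)^-1.
pose D e := (x + - signed_exp 0 (alpha + 1) e)
   * (x + - (c * signed_exp 1 1 e)) * (x ^+ 2)^-1.
pose N e := B e * (f (x * signed_exp 1 1 e) + - f x)
   + D e * (f (x * signed_exp 1 (- 1) e) + - f x).
have hN : is_derive (0 : R) (1 : R) N (- L0 alpha beta c f x).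
  have hneg (g : R -> R) dg : is_derive (0 : R) (1 : R) g dg ->
     is_derive (0 : R) (1 : R) (fun e => - g e) (- dg) by exact: is_deriveN.
  have dB := is_derive_mulf (is_derive_mulf
    (is_derive_mulf (hs 0%N (alpha + 1)) (hc (x - 1) 0))
    (is_derive_addf (is_derive_mulf (hs 1%N beta) (hc x 0)) (hc (- c) 0)))
    (hc (x ^+ 2)^-1 0).
  have dD := is_derive_mulf (is_derive_mulf
    (is_derive_addf (hc x 0) (hneg _ _ (hs 0%N (alpha + 1))))
    (is_derive_addf (hc x 0) (hneg _ _ (is_derive_mulf (hc c 0) (hs 1%N 1)))))
    (hc (x ^+ 2)^-1 0).
  apply: (is_derive_eq (is_derive_addf
    (is_derive_mulf dB (is_derive_addf (hfc 1) (hc (- f x) 0)))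
    (is_derive_mulf dD (is_derive_addf (hfc (- 1)) (hc (- f x) 0))))).
  rewrite /= !signed_exp0 /L0 /g0 /g1 !expr1 expr0.
  by rewrite !mulrN1; field.
have hq : is_derive (0 : R) (1 : R) (fun e => signed_exp 1 1 e + 1) (- 1).
  apply: (is_derive_eq (is_derive_addf (hs 1%N 1) (hc 1 0))).
  by rewrite expr1; ring.
have -> : (fun e => (signed_exp 1 1 e + 1)^-1 * bqJ_op (signed_exp 1 1 e)
    (signed_exp 1 alpha e) (signed_exp 1 beta e) c f x)
    = (fun e => N e / (signed_exp 1 1 e + 1)).
  apply/funext => e; rewrite mulrC; congr (_ / _).
  rewrite /bqJ_op /bqJ_B /bqJ_D !signed_expV !signed_expD /N /B /D.
  congr (_ * _ + _ * _).
    by rewrite [in RHS](@signed_exp_eq _ 0 (1 + 1) _ (alpha + 1)).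
  by rewrite [in RHS](@signed_exp_eq _ 0 (1 + 1) _ (alpha + 1)).
have -> : L0 alpha beta c f x = - L0 alpha beta c f x / - 1.
  by rewrite invrN1 mulrNN mulr1.
apply: cvg_ratio hN hq _ _ _.
- rewrite /N !signed_exp0 expr1 !mulrN1 -mulrDl /B /D !signed_exp0 expr0 expr1.
  by rewrite (_ : _ + _ = 0) ?mul0r //; field.
- by rewrite signed_exp0 expr1 addNr.
- by rewrite oppr_eq0 oner_eq0.
Qed.

(** * The limit operator on polynomials *)

Lemma L0_horner_sum (R : realType) (alpha beta c : R) N (p : {poly R}) x :
  (size p <= N)%N ->
  L0 alpha beta c (horner p) x =
  \sum_(k < N) p`_k * L0 alpha beta c (horner 'X^k) x.
Proof.
move=> sp.
have e : p = \sum_(k < N) p`_k *: 'X^k.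
  apply/polyP => i; rewrite -poly_def coef_poly; case: ltnP => // Ni.
  by rewrite nth_default // (leq_trans sp).
rewrite {1}e /L0 -derivE (raddf_sum (@deriv R)) !horner_sum -sumrB !mulr_sumr -sumrB.
apply: eq_bigr => k _ /=; rewrite -derivE derivZ !hornerZ; ring.
Qed.

(** For [k >= 2] the value is [x^(k-2)] times a quadratic polynomial.  For
    [k = 1] the pole at [0] cancels, as [g0] and [g1] contribute [-2c/x] and
    [2c/x] there. *)
Lemma L0_monomial (R : realType) (alpha beta c : R) k :
  exists2 r : {poly R}, (size r <= k.+1)%N &
    forall x : R, x != 0 -> L0 alpha beta c (horner 'X^k) x = r.[x].
Proof.
case: k => [|[|m]].
- exists 0; first by rewrite size_poly0.
  by move=> x x0; rewrite /L0 -derivE derivXn !hornerE; ring.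
- exists (Poly [:: -2 * (c * alpha - beta + c - 1); -2 * (alpha + beta + 2)]).
    exact: size_Poly.
  move=> x x0; rewrite /L0 /g0 /g1 -derivE derivXn horner_Poly !hornerE /=.
  by field.
(* The parity of the monomial: [(-1)^(m+2) = s]. *)
pose s : R := (-1) ^+ m; pose K : R := m.+2%:R.
pose u := [:: (s - 1) * c - 2 * s * K * c;
    (s - 1) * (c * alpha - beta) + 2 * s * K * (c - 1);
    (s - 1) * (alpha + beta + 1) + 2 * s * K].
exists ('X^m * Poly u).
  have su : (size (Poly u) <= 3)%N by exact: size_Poly.
  rewrite (leq_trans (size_polyMleq _ _)) // size_polyXn addSn.
  by rewrite -[m.+3]addn3 leq_add2l.
move=> x x0; rewrite /L0 /g0 /g1 -derivE derivXn hornerMn -[_ *+ m.+2]mulr_natl -/K.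
rewrite [RHS]hornerM [in RHS]horner_Poly !hornerXn /=.
have sx k : (- x) ^+ k = (-1) ^+ k * x ^+ k by rewrite -exprMn mulN1r.
rewrite {u} !sx !exprS -/s; move: (x ^+ m) K s => X K s.
by field.
Qed.

(** * The eigenvalue equation in the limit *)

(** One of [1 - q^-n] (for [n] even) and [1 - a b q^(n+1)] (for [n] odd)
    tends to [0] and is compared with [q + 1 = 1 - e^eps]; the other one tends
    to 2. *)
Lemma cvg_bqJ_eigen (R : realType) (alpha beta : R) n :
  (signed_exp 1 1 e + 1)^-1 * bqJ_eigen (signed_exp 1 1 e) (signed_exp 1 alpha e)
     (signed_exp 1 beta e) n @[e --> (0 : R)^'] --> lambda alpha beta n.
Proof.
pose E m s e : R := 1 - signed_exp m s e.
have -> : (fun e => (signed_exp 1 1 e + 1)^-1 * bqJ_eigen (signed_exp 1 1 e)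
    (signed_exp 1 alpha e) (signed_exp 1 beta e) n) =
  (fun e => - (E n (- n%:R) e * E n.+1 (alpha + beta + n.+1%:R) e / E 0%N 1 e)).
  apply/funext => e; rewrite /bqJ_eigen !signed_expX signed_expV !signed_expD /E.
  rewrite (@signed_exp_eq _ (1 * n) n _ (- n%:R)); [|lia|ring].
  rewrite (@signed_exp_eq _ (1 + 1 + 1 * n.+1) n.+1 _ (alpha + beta + n.+1%:R));
    [|lia|ring].
  have -> : signed_exp 1 1 e + 1 = 1 - signed_exp 0 1 e.
    by rewrite /signed_exp expr1 expr0; ring.
  by ring.
rewrite /lambda; case: ifPn => on.
- have -> : -2 * (alpha + beta + n%:R + 1)
      = - ((1 - (-1) ^+ n) * ((alpha + beta + n.+1%:R) / 1)).
    by rewrite -signr_odd on; field.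
  apply: cvgN; under eq_cvg do rewrite -mulrA.
  apply: cvgM; first exact: cvg_one_sub_signed_exp.
  by apply: cvg_one_sub_signed_exp_ratio; rewrite ?oner_eq0 //= on.
have -> : 2 * n%:R = - ((- n%:R / 1) * (1 - (-1) ^+ n.+1)) :> R.
  by rewrite -signr_odd /= on; field.
apply: cvgN; under eq_cvg do rewrite mulrAC.
apply: cvgM; last exact: cvg_one_sub_signed_exp.
by apply: cvg_one_sub_signed_exp_ratio; rewrite ?oner_eq0.
Qed.

Lemma cvg_sum_ord (R : realType) N (f : 'I_N -> R -> R) (l : 'I_N -> R) :
  (forall k, f k e @[e --> (0 : R)^'] --> l k) ->
  \sum_(k < N) f k e @[e --> (0 : R)^'] --> \sum_(k < N) l k.
Proof.
by move=> h; apply: cvg_big => // -[u v] /=; exact: add_continuous.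
Qed.

Theorem mainTheorem1 (R : realType) (alpha beta c : R)
    (halpha : -1 < alpha) (hbeta : -1 < beta) (hc : c != 0) :
  let q := fun eps : R => - expR eps in
  let a := fun eps : R => - expR (eps * alpha) in
  let b := fun eps : R => - expR (eps * beta) in
  [/\
    (* (i) *)
    (forall f : R -> R, (forall x : R, derivable f x 1) ->
      forall x : R, x != 0 ->
        ((q eps + 1)^-1 * bqJ_op (q eps) (a eps) (b eps) c f x
           @[eps --> (0 : R)^'] --> L0 alpha beta c f x)
        /\ L0 alpha beta c f x
           = g0 alpha beta c x * (reflection f x - f x)
             + g1 c x * derive1 (reflection f) x),
    (* (ii) *)
    (forall (N : nat) (p : {poly R}), (size p <= N.+1)%N ->
      exists2 r : {poly R}, (size r <= N.+1)%N &
        forall x : R, x != 0 -> L0 alpha beta c (horner p) x = r.[x])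
    (* (iii) *)
  & forall n : nat, exists Pn : {poly R},
      [/\ (forall k : nat,
             (bqJ_poly (q eps) (a eps) (b eps) c n)`_k
               @[eps --> (0 : R)^'] --> Pn`_k),
          Pn \is monic,
          size Pn = n.+1
        & forall x : R, x != 0 ->
            L0 alpha beta c (horner Pn) x = lambda alpha beta n * Pn.[x]]].
Proof.
move=> q a b.
have -> : q = signed_exp 1 1.
  by apply/funext => e; rewrite /signed_exp expr1 mulr1 mulN1r.
have -> : a = signed_exp 1 alpha.
  by apply/funext => e; rewrite /signed_exp expr1 mulN1r.
have -> : b = signed_exp 1 beta.
  by apply/funext => e; rewrite /signed_exp expr1 mulN1r.
move=> {q a b}; split.
- move=> f hf x x0; split; first exact: cvg_bqJ_op.
  exact: L0_reflection.
- move=> N p sp.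
  have [r hr] := choice (fun k : nat =>
    iffLR (exists2P _ _) (L0_monomial alpha beta c k)).
  exists (\sum_(k < N.+1) p`_k *: r k).
    apply: leq_trans (size_sum _ _ _) _; apply/bigmax_leqP => k _.
    apply: leq_trans (size_scale_leq _ _) _; have [sr _] := hr k.
    exact: leq_trans sr (ltn_ord k).
  move=> x x0; rewrite (L0_horner_sum _ _ _ _ sp) horner_sum.
  by apply: eq_bigr => k _; rewrite hornerZ; have [_ ->] := hr k.
move=> n.
pose P e := bqJ_poly (signed_exp 1 1 e) (signed_exp 1 alpha e)
  (signed_exp 1 beta e) c n.
pose Pn : {poly R} := \poly_(k < n.+1) lim ((P e)`_k @[e --> (0 : R)^']).
have szP e : size (P e) = n.+1 by case: (bqJ_poly_monic (signed_exp 1 1 e)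
  (signed_exp 1 alpha e) (signed_exp 1 beta e) c n).
have PnE k : (P e)`_k @[e --> (0 : R)^'] --> Pn`_k.
  rewrite coef_poly; case: ltnP => kn; first exact: cvg_bqJ_poly.
  under eq_cvg do rewrite nth_default ?szP //.
  exact: cvg_cst.
have Pnn : Pn`_n = 1.
  have hn : (P e)`_n @[e --> (0 : R)^'] --> (1 : R).
    have -> : (fun e => (P e)`_n) = cst 1.
      apply/funext => e; have [/monicP h _] := bqJ_poly_monic (signed_exp 1 1 e)
        (signed_exp 1 alpha e) (signed_exp 1 beta e) c n.
      by rewrite /= -h /lead_coef szP.
    exact: cvg_cst.
  exact: (cvg_unique (@norm_hausdorff _ R) (PnE n) hn).
have szPn : size Pn = n.+1.
  by rewrite size_poly_eq //; move: Pnn; rewrite coef_poly ltnSn => ->; rewrite oner_eq0.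
exists Pn; split=> //.
  by rewrite monicE /lead_coef szPn Pnn.
move=> x x0.
(* By linearity of both operators it is enough to treat monomials,
   to which [cvg_bqJ_op] applies. *)
have hL : (signed_exp 1 1 e + 1)^-1 * bqJ_op (signed_exp 1 1 e)
    (signed_exp 1 alpha e) (signed_exp 1 beta e) c (horner (P e)) x
    @[e --> (0 : R)^'] --> L0 alpha beta c (horner Pn) x.
  rewrite (@L0_horner_sum _ _ _ _ n.+1) ?szPn //.
  have -> : (fun e => (signed_exp 1 1 e + 1)^-1 * bqJ_op (signed_exp 1 1 e)
    (signed_exp 1 alpha e) (signed_exp 1 beta e) c (horner (P e)) x)
    = (fun e => \sum_(k < n.+1) (P e)`_k * ((signed_exp 1 1 e + 1)^-1 *
        bqJ_op (signed_exp 1 1 e) (signed_exp 1 alpha e) (signed_exp 1 beta e) c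
          (horner 'X^k) x)).
    apply/funext => e.
    have -> : horner (P e) = (fun y => \sum_(k < n.+1) (P e)`_k * ('X^k).[y]).
      apply/funext => y; rewrite (@horner_coef_wide _ n.+1) ?szP //.
      by apply: eq_bigr => k _; rewrite hornerXn.
    by rewrite bqJ_op_sum mulr_sumr; apply: eq_bigr => k _; rewrite mulrCA.
  apply: cvg_sum_ord => k; apply: cvgM; first exact: PnE.
  by apply: cvg_bqJ_op => // y; exact: derivable_horner.
have hR : (signed_exp 1 1 e + 1)^-1 * bqJ_eigen (signed_exp 1 1 e)
    (signed_exp 1 alpha e) (signed_exp 1 beta e) n * (P e).[x]
    @[e --> (0 : R)^'] --> lambda alpha beta n * Pn.[x].
  apply: cvgM; first exact: cvg_bqJ_eigen.
  rewrite horner_coef szPn.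
  have -> : (fun e => (P e).[x]) = (fun e => \sum_(k < n.+1) (P e)`_k * x ^+ k).
    by apply/funext => e; rewrite horner_coef szP.
  by apply: cvg_sum_ord => k; apply: cvgM; [exact: PnE | exact: cvg_cst].
apply: (cvg_unique (@norm_hausdorff _ R) hL).
apply: (cvg_trans _ hR); apply: near_eq_cvg; near=> e.
rewrite bqJ_op_poly ?mulrA //.
by near: e; exact: near_bqJ_nondegenerate.
Unshelve. all: by end_near. Qed.
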